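(* Let $\gamma=d_I+2$ and $\gamma_0=\lfloor (d_I+1)/2\rfloor$. For every $\sigma\ge \gamma/\gamma_0+1$, $\sigma$-FIFO is a $\sigma$-speed optimal algorithm for both C-WGP and F-WGP; that is, on every instance, $\max_j C_{j,\sigma}$ is at most the optimal (unit-speed) value of $\max_j C_j$, and $\max_j F_{j,\sigma}$ is at most the optimal (unit-speed) value of $\max_j F_j$.
   Context: The Wireless Gathering Problem (WGP). An instance consists of a finite connected undirected graph $G=(V,E)$, a sink node $s\in V$, a positive integer $d_I$ (interference radius), and a set of packets $J=\{1,\dots,m\}$; each packet $j$ has an origin $o_j\in V$ and a release date $r_j\in\mathbb{Z}_{\ge 0}$. Time is divided into rounds $0,1,2,\dots$. In a round, if $u,v$ are adjacent, $u$ may send a packet it currently holds to $v$; this is a call $(u,v)$. Let $d(u,v)$ be the shortest-path distance in $G$. Two calls $(u,v)$ and $(u',v')$ in the same round interfere if $d(u',v)\le d_I$ or $d(u,v')\le d_I$; otherwise they are compatible. A feasible schedule specifies, for each round, a set of pairwise compatible calls, each moving one packet, such that every packet exists in a unique copy, packet $j$ is not sent before its release date, and every packet eventually reaches $s$. The completion time $C_j$ is the time at which packet $j$ arrives at $s$ (a packet sent in round $t$ is at its new node at time $t+1$) and the flow time is $F_j=C_j-r_j$. C-WGP minimizes $\max_j C_j$, F-WGP minimizes $\max_j F_j$. Priority Greedy: each packet is given a unique priority; in every round, the available packets (released and not yet at $s$) are considered in order of decreasing priority, and each is sent from its current node to a neighbor one step closer to $s$, provided this call causes no interference with the calls already chosen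 in this round for higher-priority packets. FIFO is the Priority Greedy algorithm in which packets with earlier release dates have higher priority (ties broken arbitrarily). $\sigma$-FIFO: (1) form instance $\mathcal{I}'$ from the given instance by setting release dates $r'_j=\sigma r_j$ (a packet may be sent in round $t$ of $\mathcal{I}'$ only if $t\ge \sigma r_j$); (2) run FIFO on $\mathcal{I}'$, obtaining completion times $C'_j$; (3) speed this schedule up by a factor $\sigma$, so round $t$ is executed at time $t/\sigma$ and packet $j$ has completion time $C_{j,\sigma}=C'_j/\sigma$ and flow time $F_{j,\sigma}=C_{j,\sigma}-r_j$. A $\sigma$-speed algorithm is $\sigma$-speed optimal if on every instance its cost is at most the optimal cost among ordinary (unit-speed) feasible schedules. *)

(* Defs.v *)
From HB Require Import structures.
From mathcomp Require Import all_boot all_order all_algebra.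
From mathcomp Require Import boolp reals.

Set Implicit Arguments.
Unset Strict Implicit.
Unset Printing Implicit Defensive.

Import Order.TTheory GRing.Theory Num.Theory.
Local Open Scope ring_scope.

(* Shortest-path distance of the graph [e]: the first n < #|T| such that some
   walk with n edges leads from u to v.  In a connected graph such an n always
   exists; otherwise the value is #|T|. *)
Definition gdist (T : finType) (e : rel T) (u v : T) : nat :=
  find (fun n => [exists p : n.-tuple T, path e u p && (last u p == v)])
       (iota 0 #|T|).

Record wgp := Wgp {
  node : finType;
  adj : rel node;
  adj_sym : symmetric adj;
  adj_irr : irreflexive adj;
  adj_conn : forall u v, connect adj u v;
  sink : node;
  dI : nat;
  dI_gt0 : (0 < dI)%N;
  npackets : nat;
  origin : 'I_npackets -> node;
  release : 'I_npackets -> nat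
}.

Notation packet I := 'I_(npackets I).

Definition gamma (I : wgp) : nat := (dI I + 2)%N.
Definition gamma0 (I : wgp) : nat := ((dI I + 1) %/ 2)%N.

Section Schedules.
Variable I : wgp.

Definition dist (u v : node I) : nat := gdist (@adj I) u v.

Definition compatible (c c' : node I * node I) : bool :=
  ~~ ((dist c'.1 c.2 <= dI I)%N || (dist c.1 c'.2 <= dI I)%N).

(* [S t j = Some v] means that in round t the node holding packet j sends it to
   v; [S t j = None] means that packet j is not sent in round t. *)
Definition schedule := nat -> packet I -> option (node I).

(* Node holding packet j at time t, i.e. at the beginning of round t. *)
Fixpoint position (S : schedule) (t : nat) (j : packet I) : node I :=
  if t is t'.+1 then odflt (position S t' j) (S t' j) else origin j.

Definition delivers (S : schedule) : Prop :=
  forall j, exists t, position S t j == sink I.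

(* The first time at which packet j is at the sink (0 if this never happens). *)
Definition arrival (S : schedule) (j : packet I) : nat :=
  if pselect (exists t, position S t j == sink I) is left h
  then ex_minn h else 0%N.

Variable R : realType.

(* Release dates are a separate, real-valued argument [r], so that the same
   definitions apply to I and to the instance with release dates stretched by
   a real factor. *)
Implicit Type r : packet I -> R.

Definition feasible r (S : schedule) : Prop :=
  [/\ forall t j v, S t j = Some v -> adj (position S t j) v,
      forall t j v, S t j = Some v -> r j <= t%:R,
      forall t j k v w, j != k -> S t j = Some v -> S t k = Some w ->
        compatible (position S t j, v) (position S t k, w)
    & delivers S].

(* The maximum only matters for a packet whose origin is the sink: it is
   completed when it is released. *)
Definition completion r (S : schedule) (j : packet I) : R :=
  Num.max (r j) (arrival S j)%:R.

Definition available r (S : schedule) (t : nat) (j : packet I) : bool :=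
  (r j <= t%:R) && (position S t j != sink I).

Definition one_step_closer (u v : node I) : bool :=
  adj u v && (dist u (sink I) == (dist v (sink I)).+1).

Definition causes_no_interference (prio : packet I -> nat) (S : schedule)
    (t : nat) (j : packet I) (v : node I) : Prop :=
  forall k w, (prio k < prio j)%N -> S t k = Some w ->
    compatible (position S t j, v) (position S t k, w).

(* [prio k < prio j] means that k has higher priority than j.  In each round
   the next hop v of an available packet is an arbitrary neighbour one step
   closer to the sink. *)
Definition priority_greedy r (prio : packet I -> nat) (S : schedule) : Prop :=
  forall t j,
    if available r S t j then
      exists2 v, one_step_closer (position S t j) v &
        (causes_no_interference prio S t j v /\ S t j = Some v) \/
        (~ causes_no_interference prio S t j v /\ S t j = None)
    else S t j = None.

Definition fifo r (S : schedule) : Prop :=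
  exists prio : packet I -> nat,
    [/\ injective prio,
        forall j k, r j < r k -> (prio j < prio k)%N
      & priority_greedy r prio S].

Definition unit_release (j : packet I) : R := (release j)%:R.

Definition C (S : schedule) (j : packet I) : R := completion unit_release S j.
Definition F (S : schedule) (j : packet I) : R := C S j - unit_release j.

Variable sigma : R.

Definition scaled_release (j : packet I) : R := sigma * unit_release j.

(* [S] is the schedule for the scaled instance, before it is sped up. *)
Definition sigma_fifo (S : schedule) : Prop := fifo scaled_release S.

Definition C_speed (S : schedule) (j : packet I) : R :=
  completion scaled_release S j / sigma.
Definition F_speed (S : schedule) (j : packet I) : R :=
  C_speed S j - unit_release j.

End Schedules.

(* All completion and flow times are nonnegative, so 0 is a neutral start value. *)
Definition maxcost (R : realType) (n : nat) (f : 'I_n -> R) : R :=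
  \big[Num.max/0]_(j < n) f j.

(* The cost [c] is at most the cost [f] of every ordinary feasible schedule,
   i.e. at most the optimal unit-speed cost. *)
Definition at_most_optimal (R : realType) (I : wgp) (c : R)
    (f : schedule I -> packet I -> R) : Prop :=
  forall S, feasible (@unit_release I R) S -> c <= maxcost (f S).

(* Main.v *)
(* In Priority Greedy, a packet j that is blocked for the last time by k has
   distance at most gamma more than k from the sink, and then runs freely, so it
   arrives at most min(d_j, gamma) after k.  Following blockers back to a packet i
   that is never blocked yields a set K of packets with
     C'_j <= ceil(sigma r_i) + d_i + sum_(k in K, k != i) min(d_k, gamma),
   where under FIFO i has the earliest and j the latest release date in K.  In any
   feasible schedule at most one packet per round can come closer to the sink
   within radius gamma0, so the last packet of K arrives no earlier than
   r_i + sum_(k in K) min(d_k, gamma0), and i itself no earlier than r_i + d_i.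
   Comparing the bounds, some k in K has C_k >= C_{j,sigma}; as r_k <= r_j, the
   same k also dominates the flow time of j. *)
Require Import Defs.
From mathcomp Require Import all_boot all_order all_algebra.
From mathcomp Require Import boolp reals.
From mathcomp Require Import zify lra.
Set Implicit Arguments.
Unset Strict Implicit.
Unset Printing Implicit Defensive.
Import Order.TTheory GRing.Theory Num.Theory.
Local Open Scope ring_scope.

(** * Shortest-path distance as a metric *)

(** [find] never exceeds [#|T|], the length of the searched list. A result above [size p] would thus
    mean that [size p] was tested and rejected, although [p] realizes it. *)
Lemma gdist_le_walk (T : finType) (e : rel T) (u : T) (p : seq T) :
  path e u p -> (gdist e u (last u p) <= size p)%N.
Proof.
move=> ep; rewrite leqNgt; apply/negP => lt_p.
have lt_pT : (size p < #|T|)%N.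
  by rewrite (leq_trans lt_p) // -[X in (_ <= X)%N](size_iota 0) find_size.
have /= := before_find 0 lt_p; rewrite nth_iota // add0n => /existsP[].
by exists (in_tuple p); rewrite /= ep eqxx.
Qed.

(** A walk without repeated vertices has fewer than [#|T|] edges, so the search in [gdist]
    succeeds. *)
Lemma gdist_walk {T : finType} {e : rel T} {u v : T} :
  connect e u v -> exists p, [/\ path e u p, last u p = v & size p = gdist e u v].
Proof.
move=> /connectP[p0 /shortenP[p ep Up _] ->].
set a := fun n : nat => [exists q : n.-tuple T, path e u q && (last u q == last u p)].
have lt_p : (size p < #|T|)%N by have := max_card (mem (u :: p)); rewrite (card_uniqP Up).
have : has a (iota 0 #|T|).
  apply/hasP; exists (size p); first by rewrite mem_iota.
  by apply/existsP; exists (in_tuple p); rewrite /= ep eqxx.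
move=> ha; have := nth_find 0 ha; rewrite has_find size_iota in ha.
rewrite nth_iota // add0n => /existsP[q /andP[eq /eqP lq]].
by exists q; split; rewrite ?size_tuple.
Qed.

Section Distance.
Context {I : wgp}.
Implicit Types u v w : node I.

Lemma distxx u : dist u u = 0%N.
Proof. by apply/eqP; rewrite -leqn0; apply: (@gdist_le_walk _ _ u [::]). Qed.

Lemma dist_eq0 u v : (dist u v == 0%N) = (u == v).
Proof.
apply/eqP/eqP => [|->]; last exact: distxx.
rewrite /dist; have [p [_ <- <-]] := gdist_walk (adj_conn u v).
by case: p.
Qed.

Lemma dist_triangle u v w : (dist u w <= dist u v + dist v w)%N.
Proof.
have [p [ep lp sp]] := gdist_walk (adj_conn u v).
have [q [eq lq sq]] := gdist_walk (adj_conn v w).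
rewrite /dist -sp -sq -size_cat -lq -{1}lp -last_cat gdist_le_walk //.
by rewrite cat_path ep lp.
Qed.

Lemma dist_le1 u v : adj u v -> (dist u v <= 1)%N.
Proof. by move=> uv; apply: (@gdist_le_walk _ _ u [:: v]); rewrite /= uv. Qed.

Lemma dist_sym u v : dist u v = dist v u.
Proof.
suff le (x y : node I) : (dist x y <= dist y x)%N by apply/eqP; rewrite eqn_leq !le.
have [p [ep lp sp]] := gdist_walk (adj_conn y x).
have := @gdist_le_walk _ (@adj I) x (rev (belast y p)).
rewrite -{1}lp rev_path (eq_path (e' := @adj I)) => [/(_ ep)|a b]; last exact: adj_sym.
rewrite size_rev size_belast sp; suff -> : last x (rev (belast y p)) = y by [].
by rewrite -lp; case: (p) => //= z p'; rewrite rev_cons last_rcons.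
Qed.

End Distance.

(** * Distance of packets to the sink over time *)

Definition level {I : wgp} (S : schedule I) (t : nat) (j : packet I) : nat :=
  dist (position S t j) (sink I).

Section Walks.
Context {I : wgp} {S : schedule I}.
Implicit Type j : packet I.

Lemma level_eq0 t j : (level S t j == 0%N) = (position S t j == sink I).
Proof. exact: dist_eq0. Qed.

Lemma level_step t j :
    (forall v, S t j = Some v -> adj (position S t j) v) ->
  (level S t j <= (level S t.+1 j).+1)%N.
Proof.
rewrite /level /=; case: (S t j) => [v /(_ v erefl) uv|_] //=.
by rewrite (leq_trans (dist_triangle _ v _)) // -add1n leq_add2r dist_le1.
Qed.

Lemma level_le_add j :
    (forall t v, S t j = Some v -> adj (position S t j) v) ->
  forall t n, (level S t j <= level S (t + n) j + n)%N.
Proof.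
move=> walk t; elim=> [|n IHn]; first by rewrite !addn0.
by have := @level_step (t + n) j (walk _); rewrite !addnS; lia.
Qed.

Lemma level_unmoved j (a : nat) :
  (forall t, (t < a)%N -> S t j = None) -> forall t, (t <= a)%N -> level S t j = level S 0 j.
Proof.
move=> stay; elim=> [//|t IHt] lt_ta.
by rewrite /level /= stay //= -/(level S t j) IHt // ltnW.
Qed.

Lemma arrivalP j : (exists t, position S t j == sink I) ->
  position S (arrival S j) j = sink I.
Proof.
by rewrite /arrival; case: pselect => // h _; case: ex_minnP => t /eqP.
Qed.

Lemma arrival_min j t : position S t j == sink I -> (arrival S j <= t)%N.
Proof.
move=> jt; rewrite /arrival; case: pselect => // h.
by case: ex_minnP => n _; apply.
Qed.

Lemma level_gt0_before j t : (t < arrival S j)%N -> (0 < level S t j)%N.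
Proof.
by rewrite ltnNge lt0n level_eq0; apply: contra => /arrival_min.
Qed.

End Walks.

(** * Lower bounds on arrivals in a feasible schedule *)

Section OptimalSchedule.
Context {I : wgp} {R : realType} {S : schedule I}.
Hypothesis feasS : feasible (@unit_release I R) S.
Implicit Types j k : packet I.

Let walk j t v : S t j = Some v -> adj (position S t j) v.
Proof. by case: feasS => + _ _ _; apply. Qed.

Let level_arrival j : level S (arrival S j) j = 0%N.
Proof.
by case: feasS => _ _ _ dS; apply/eqP; rewrite level_eq0 arrivalP.
Qed.

Lemma feasible_unmoved j t : (t <= release j)%N -> level S t j = level S 0 j.
Proof.
apply: level_unmoved => s lt_s; case Es: (S s j) => [v|] //.
case: feasS => _ /(_ s j v Es) + _ _.
by rewrite /unit_release ler_nat leqNgt lt_s.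
Qed.

(** The packet stands still until its release and then gains at most one edge per round. A packet
    starting at the sink is excluded: its [arrival] is 0 whatever its release date. *)
Lemma release_add_level_le_arrival j :
  (0 < level S 0 j)%N -> (release j + level S 0 j <= arrival S j)%N.
Proof.
move=> j_gt0; have [le_a|lt_a] := leqP (arrival S j) (release j).
  by move: (feasible_unmoved le_a); rewrite level_arrival => E; rewrite -E in j_gt0.
have := level_le_add (@walk j) (release j) (arrival S j - release j).
rewrite subnKC ?(ltnW lt_a) // level_arrival feasible_unmoved //; lia.
Qed.

(* A packet is frozen at its first arrival, since a feasible schedule may send
   it away from the sink again. *)
Definition near_level j t : nat :=
  if (t < arrival S j)%N then minn (level S t j) (gamma0 I) else 0%N.

Lemma near_level_step j t : (near_level j t <= (near_level j t.+1).+1)%N.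
Proof.
rewrite /near_level; have := @level_step I S t j (@walk j t).
have [lt|//] := ltnP t (arrival S j).
have [_|le] := ltnP t.+1 (arrival S j); first lia.
have -> : t.+1 = arrival S j by lia.
by rewrite level_arrival; lia.
Qed.

Lemma near_level_drop j t : (near_level j t.+1 < near_level j t)%N ->
  exists v, [/\ S t j = Some v, (level S t j <= gamma0 I)%N
              & (level S t j = (dist v (sink I)).+1)].
Proof.
rewrite /near_level; have [lt_t|_] := ltnP t (arrival S j); last by rewrite ltn0.
have -> : (if (t.+1 < arrival S j)%N then minn (level S t.+1 j) (gamma0 I) else 0%N) =
     minn (level S t.+1 j) (gamma0 I).
  have [//|le] := ltnP t.+1 (arrival S j); have -> : t.+1 = arrival S j by lia.
  by rewrite level_arrival min0n.
have := @level_step I S t j (@walk j t).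
rewrite [level S t.+1 j]/level /=; case: (S t j) => [v|] /=; last by rewrite -/(level S t j); lia.
by exists v; split=> //; lia.
Qed.

(* Two packets moving inward within distance gamma0 of the sink interfere,
   because 2 * gamma0 - 1 <= d_I. *)
Lemma near_level_drop_unique j k t :
    (near_level j t.+1 < near_level j t)%N ->
    (near_level k t.+1 < near_level k t)%N -> j = k.
Proof.
move=> /near_level_drop[v [Sj le_j Ej]] /near_level_drop[w [Sk le_k Ek]].
apply/eqP; apply: contraT => jk; case: feasS => _ _ /(_ t j k v w jk Sj Sk) + _.
rewrite /compatible /= negb_or => /andP[_]; rewrite -ltnNge.
have := dist_triangle (position S t j) (sink I) w.
rewrite -/(level S t j) (dist_sym (sink I)).
by move: le_j le_k; rewrite /gamma0; lia.
Qed.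

(** At most one summand drops in a round, and it drops by at most one. *)
Lemma sum_near_level_step (K : {set packet I}) t :
  (\sum_(k in K) near_level k t <= (\sum_(k in K) near_level k t.+1).+1)%N.
Proof.
have [/existsP[j /andP[jK lt_j]]|/existsPn none] :=
    boolP [exists j, (j \in K) && (near_level j t.+1 < near_level j t)%N].
  rewrite (bigD1 j) //= [X in (_ <= X.+1)%N](bigD1 j) //= -addSn.
  rewrite leq_add ?near_level_step // leq_sum // => k /andP[kK kj].
  rewrite leqNgt; apply: contra kj => lt_k.
  by rewrite (near_level_drop_unique lt_k lt_j).
rewrite leqW // leq_sum // => k kK.
by have := none k; rewrite kK /= -leqNgt.
Qed.

Lemma near_level_release j t : (t <= release j)%N ->
  near_level j t = minn (level S 0 j) (gamma0 I).
Proof.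
move=> le_t; rewrite /near_level; case: ltnP => [_|le_a]; first by rewrite feasible_unmoved.
by rewrite -(feasible_unmoved (leq_trans le_a le_t)) level_arrival min0n.
Qed.

(** The sum of [near_level] over [K] has its full value [Phi] at time [rho] and loses at most one
    per round. It is still positive at time [rho + Phi - 1], so some packet of [K] has not arrived
    by then. *)
Lemma exists_late_arrival (K : {set packet I}) (rho : nat) :
    (forall k, k \in K -> (rho <= release k)%N) ->
    (0 < \sum_(k in K) minn (level S 0 k) (gamma0 I))%N ->
  exists2 k, k \in K &
    (rho + \sum_(k in K) minn (level S 0 k) (gamma0 I) <= arrival S k)%N.
Proof.
move=> rhoK; set Phi := (\sum_(k in K) _)%N => Phi_gt0.
have [/existsP[k /andP[kK le_k]]|/existsPn early] :=
  boolP [exists k, (k \in K) && (rho + Phi <= arrival S k)%N]; first by exists k.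
have descent n : (Phi <= \sum_(k in K) near_level k (rho + n) + n)%N.
  elim: n => [|n IHn]; last by have := sum_near_level_step K (rho + n); rewrite !addnS; lia.
  by rewrite !addn0 leq_sum // => k kK; rewrite near_level_release // rhoK.
have := descent Phi.-1; rewrite big1; first lia.
move=> k kK; rewrite /near_level ifN // -leqNgt.
by have := early k; rewrite kK /= -ltnNge; lia.
Qed.

End OptimalSchedule.

(** * Upper bound on arrivals under Priority Greedy *)

Section Greedy.
Context {I : wgp} {R : realType} {r : packet I -> R} {prio : packet I -> nat}.
Context {S : schedule I}.
Hypothesis greedyS : priority_greedy r prio S.
Implicit Types j k : packet I.

Lemma greedy_sent j t v : S t j = Some v ->
  [/\ available r S t j, adj (position S t j) v & level S t j = (level S t.+1 j).+1].
Proof.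
move=> Sj; have := greedyS t j; case: ifP => [_|_]; last by rewrite Sj.
case=> u /andP[ju /eqP Eu] [] [_]; rewrite Sj // => -[Euv].
by rewrite /level /= Sj /= Euv.
Qed.

Let walk j t v : S t j = Some v -> adj (position S t j) v.
Proof. by case/greedy_sent. Qed.

Lemma greedy_level_le j t : (level S t.+1 j <= level S t j)%N.
Proof.
case E: (S t j) => [v|]; first by have [_ _ ->] := greedy_sent E.
by rewrite {1}/level /= E.
Qed.

Lemma greedy_level_le0 j t : (level S t j <= level S 0 j)%N.
Proof. by elim: t => // t IHt; rewrite (leq_trans (greedy_level_le _ _)). Qed.

Lemma greedy_at_sink j t n : position S t j = sink I -> position S (t + n) j = sink I.
Proof.
move=> jt; apply/eqP; rewrite -level_eq0 -leqn0.
have <- : level S t j = 0%N by apply/eqP; rewrite level_eq0 jt.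
by elim: n => [|n IHn]; rewrite ?addn0 // addnS (leq_trans (greedy_level_le _ _)).
Qed.

(** Triangle inequality across the interfering pair. If the sender of [k] is within d_I of the next
    hop of [j], the two hops add one each, whence d_I + 2; in the other case d_I suffices. *)
Lemma greedy_blocked j t : available r S t j -> S t j = None ->
  exists k w, [/\ (prio k < prio j)%N, S t k = Some w
                & (level S t j <= level S t.+1 k + gamma I)%N].
Proof.
move=> av Sj; have := greedyS t j; rewrite av => -[v /andP[jv /eqP Ev]].
rewrite Sj => -[[_ //]|[interf _]].
have [k [w [lt_kj Sk ncomp]]] : exists k w, [/\ (prio k < prio j)%N, S t k = Some w
    & ~~ compatible (position S t j, v) (position S t k, w)].
  apply: contrapT => noblock; apply: interf => k w lt_kj Sk.
  by apply: contrapT => /negP nc; apply: noblock; exists k, w.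
exists k, w; split=> //; have [_ _] := greedy_sent Sk.
have Ew : level S t.+1 k = dist w (sink I) by rewrite /level /= Sk.
move: ncomp; rewrite /compatible /= negbK Ew /gamma /level Ev.
have := dist_triangle v (position S t k) (sink I).
have := dist_triangle (position S t j) w (sink I).
rewrite (dist_sym v (position S t k)) Ev -/(level S t k) => tri1 tri2 /orP[] le Ek; lia.
Qed.

(* The last blocker [k] of [j] is at most gamma closer to the sink than [j],
   and from then on [j] moves in every round. *)
Lemma greedy_arrival_step j (a : nat) :
    (forall t, (a <= t)%N -> r j <= t%:R) ->
    (forall k, (prio k < prio j)%N -> exists t, position S t k == sink I) ->
  (exists t, position S t j == sink I) /\
  (0 < level S 0 j -> arrival S j <= a + level S 0 j \/
     exists k, [/\ prio k < prio j, 0 < level S 0 k &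
       arrival S j <= arrival S k + minn (level S 0 j) (gamma I)])%N.
Proof.
move=> rel_j reach; pose d := level S 0 j.
(* [X] is a deadline for [j], renewed at each blocking. The invariant [inv] says that from round [a]
   on the level of [j] is at most the number of rounds left until [X]. *)
pose good X := (X = a + d \/ exists k, [/\ prio k < prio j, 0 < level S 0 k &
  X = arrival S k + minn d (gamma I)])%N.
have inv t : exists2 X, good X & (level S t j <= d /\ (a <= t -> level S t j <= X - t))%N.
  elim: t => [|t [X gX [le_d IHt]]].
    by exists (a + d)%N; [left|split=> // _; rewrite subn0 leq_addl].
  have le_d' : (level S t.+1 j <= d)%N := greedy_level_le0 _ _.
  have [lt_at|le_ta] := leqP a t; last first.
    by exists (a + d)%N; [left|split=> // le; lia].
  case Sj: (S t j) => [v|].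
    have [_ _ Ev] := greedy_sent Sj.
    by exists X => //; split=> // _; have := IHt lt_at; lia.
  have El : level S t.+1 j = level S t j by rewrite {1}/level /= Sj.
  have [snk|nsnk] := eqVneq (position S t j) (sink I).
    by exists X => //; split=> // _; rewrite El (eqP (_ : level S t j == 0%N)) // level_eq0 snk.
  have [|k [w [lt_k Sk le_k]]] := greedy_blocked _ Sj.
    by rewrite /available nsnk rel_j.
  have [/andP[_ nsk] _ Ek] := greedy_sent Sk.
  have ak := arrivalP (reach k lt_k).
  have lt_tk : (t < arrival S k)%N.
    rewrite ltnNge; apply: contra nsk => le_kt.
    by rewrite -(subnKC le_kt) greedy_at_sink.
  (* As [k] gains at most one edge per round, its level after round [t] is at most the number of
     rounds left until its arrival. *)
  have := level_le_add (@walk k) t.+1 (arrival S k - t.+1).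
  rewrite subnKC // (eqP (_ : level S (arrival S k) k == 0%N)); last by rewrite level_eq0 ak.
  have k0 : (0 < level S 0 k)%N by have := greedy_level_le0 k t; lia.
  exists (arrival S k + minn d (gamma I))%N; first by right; exists k.
  by split=> // _; lia.
have reach_j : exists t, position S t j == sink I.
  (* [B] lies beyond every possible deadline, so the level of [j] at time [B] is 0. *)
  pose B := (a + d + \sum_k (arrival S k + d))%N.
  have [X gX [_ le_X]] := inv B; exists B; rewrite -level_eq0.
  have {}le_X : (level S B j <= X - B)%N by apply: le_X; rewrite /B; lia.
  suff : (X <= B)%N by lia.
  case: gX => [->|[k [_ _ ->]]]; rewrite /B; first exact: leq_addr.
  by rewrite (bigD1 k) //=; lia.
split=> // j0; have a_gt0 : (0 < arrival S j)%N.
  by rewrite lt0n; apply: contraTneq j0 => E; rewrite -leqNgt leqn0 level_eq0 -E arrivalP.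
(* One round before its arrival [j] still has positive level, so the deadline valid then is at least
   the arrival time. *)
have [X gX [_ le_X]] := inv (arrival S j).-1.
have lv : (0 < level S (arrival S j).-1 j)%N by apply: level_gt0_before; lia.
have [le_a|lt_a] := leqP a (arrival S j).-1; last by left; lia.
have {}le_X := le_X le_a.
case: gX => [EX|[k [lt_k k0 EX]]]; first by left; lia.
by right; exists k; split=> //; rewrite -/d; lia.
Qed.

(** Strong induction on [prio]: a packet is blocked only by packets of higher priority, and these
    reach the sink. *)
Lemma greedy_delivers : delivers S.
Proof.
move=> j; have [n] := ubnP (prio j); elim: n j => // n IHn j lt_j.
apply: (@greedy_arrival_step j (Num.truncn (r j)).+1 _ _).1 => [t lt_t|k lt_k].
  by rewrite (le_trans (ltW (truncnS_gt (r j)))) // ler_nat.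
by apply: IHn; lia.
Qed.

(** Induction on [prio] along last blockers: each link adds the blocked packet to [K] at cost min(d,
    gamma), and the chain ends at a packet [i] bounded by its free run. *)
Lemma greedy_arrival_chain (a : packet I -> nat) j :
    (forall k t, (a k <= t)%N -> r k <= t%:R) -> (0 < level S 0 j)%N ->
  exists i (K : {set packet I}), [/\ i \in K, (0 < level S 0 i)%N,
    forall k, k \in K -> (prio i <= prio k <= prio j)%N &
    (arrival S j <=
      a i + level S 0 i + \sum_(k in K :\ i) minn (level S 0 k) (gamma I))%N].
Proof.
move=> rel; have [n] := ubnP (prio j); elim: n j => // n IHn j lt_j j0.
have [|_ /(_ j0)[le_j|[k [lt_k k0 le_j]]]] :=
    greedy_arrival_step (rel j); first by move=> k _; exact: greedy_delivers.
  exists j, [set j]; split=> // [|k /set1P ->|]; rewrite ?set11 ?leqnn //.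
  by rewrite (leq_trans le_j) ?leq_addr.
have [|i [K [iK i0 bK le_k]]] := IHn k _ k0; first lia.
exists i, (j |: K); split=> //; first by rewrite setU1r.
  move=> h /setU1P[->|/bK]; last lia.
  by have := bK i iK; lia.
(* Priorities in [K] do not come after that of [k], which precedes [j]; so the sum gains exactly the
   term of [j]. *)
have jK : j \notin K by apply/negP => /bK; lia.
have ij : i != j by apply: contraNneq jK => <-.
rewrite (bigD1 j) /=; last by rewrite !inE eqxx eq_sym ij.
rewrite [X in (_ + (_ + X))%N](eq_bigl (fun h => h \in K :\ i)); first by rewrite [X in (_ + X)%N]addnC addnA (leq_trans le_j) // leq_add2r.
move=> h; rewrite !inE; case: (eqVneq h j) => [->|]; last by rewrite andbT.
by rewrite (negPf jK) !andbF.
Qed.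

End Greedy.

(** * Comparison of the bounds for both objectives *)

Lemma le_maxcost {R : realType} {n : nat} (f g : 'I_n -> R) :
  (forall j, exists k, f j <= g k) -> maxcost f <= maxcost g.
Proof.
move=> fg; apply: bigmax_le => [|j _]; first exact: bigmax_ge_id.
by have [k le_fg] := fg j; rewrite (le_trans le_fg) // le_bigmax.
Qed.

Lemma gamma0_gt0 (I : wgp) : (0 < gamma0 I)%N.
Proof. by have := dI_gt0 I; rewrite /gamma0; lia. Qed.

Lemma gamma0_le_gamma (I : wgp) : (gamma0 I <= gamma I)%N.
Proof. by rewrite /gamma0 /gamma; lia. Qed.

(* The [1] stands for rounding the first release date up to a round; the term of
   [i] on the right pays for it. *)
Lemma gamma0_mul_delay {I : wgp} (d : packet I -> nat) (i : packet I)
    (K : {set packet I}) : i \in K -> (0 < d i)%N ->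
  (gamma0 I * (1 + \sum_(k in K :\ i) minn (d k) (gamma I))
     <= gamma I * \sum_(k in K) minn (d k) (gamma0 I))%N.
Proof.
move=> iK di; have g0 := gamma0_gt0 I; have gg := gamma0_le_gamma I.
rewrite (bigD1 i iK) /= !mulnDr leq_add //; first by nia.
rewrite !big_distrr /= (eq_bigl (fun k => (k \in K) && (k != i))) => [|k].
  by apply: leq_sum => k _; nia.
by rewrite !inE andbC.
Qed.

Lemma sigma_fifo_dominated {R : realType} {I : wgp} {sigma : R}
    {S S' : schedule I} (j : packet I) :
    (gamma I)%:R / (gamma0 I)%:R + 1 <= sigma -> sigma_fifo sigma S ->
    feasible (@unit_release I R) S' ->
  exists2 k, (release k <= release j)%N & C_speed sigma S j <= C R S' k.
Proof.
move=> hsigma [prio [_ prio_rel greedyS]] feasS'.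
have g0 : 0 < (gamma0 I)%:R :> R by rewrite ltr0n gamma0_gt0.
have sigma_ge1 : 1 <= sigma.
  by rewrite (le_trans _ hsigma) // lerDr divr_ge0 // ler0n.
have sigma_gt0 : 0 < sigma by rewrite (lt_le_trans ltr01).
(* [a k] is the ceiling of sigma r_k, the first round in which [k] may be sent; [Num.truncn] only
   witnesses that such a round exists. *)
pose a (k : packet I) := ex_minn (ex_intro (fun n => scaled_release sigma k <= n%:R)
  (Num.truncn (scaled_release sigma k)).+1 (ltW (truncnS_gt _))).
have rel k t : (a k <= t)%N -> scaled_release sigma k <= t%:R.
  rewrite /a; case: ex_minnP => n le_n _ le_t.
  by rewrite (le_trans le_n) // ler_nat.
have lt_a k : (a k)%:R < scaled_release sigma k + 1.
  rewrite /a; case: ex_minnP => -[|n] le_n min_n.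
    by rewrite ltr_wpDl // mulr_ge0 ?ler0n // ltW.
  rewrite -natr1 ltrD2r ltNge; apply/negP => /min_n; lia.
have rel_le k : (prio k <= prio j)%N -> (release k <= release j)%N.
  move=> le_kj; rewrite leqNgt; apply/negP => lt_jk.
  suff : (prio j < prio k)%N by lia.
  by apply: prio_rel; rewrite ltr_pM2l // ltr_nat.
have C_ge k (x : nat) : (x <= arrival S' k)%N -> x%:R <= C R S' k.
  by move=> le_x; rewrite /C /completion le_max [X in _ || X]ler_nat le_x orbT.
have C_ge_rel k : unit_release R k <= C R S' k by rewrite /C /completion le_max lexx.
suff [k le_k le_C] : exists2 k, (release k <= release j)%N &
    (arrival S j)%:R <= sigma * C R S' k.
  have le_speed x : unit_release R j <= x -> (arrival S j)%:R <= sigma * x ->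
      C_speed sigma S j <= x.
    by move=> le1 le2; rewrite /C_speed ler_pdivrMr // mulrC ge_max ler_pM2l ?le1.
  (* Completion is also bounded below by release. If [k] completes before [j] is released, [j]
     itself serves as the dominating packet. *)
  have [le_j|lt_j] := leP (unit_release R j) (C R S' k); first by exists k; auto.
  exists j => //; apply: le_speed => //; rewrite (le_trans le_C) // ler_pM2l //.
  by rewrite (le_trans (ltW lt_j)).
have [j0|j_gt0] := posnP (level S 0 j).
  exists j => //; have /arrival_min : position S 0 j == sink I by rewrite -level_eq0 j0.
  rewrite leqn0 => /eqP ->.
  by rewrite mulr_ge0 ?(ltW sigma_gt0) // (le_trans _ (C_ge_rel j)) ?ler0n.
have [i [K [iK i_gt0 bK le_j]]] := greedy_arrival_chain greedyS rel j_gt0.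
have relK k : k \in K -> (release i <= release k)%N.
  move=> /bK/andP[le_ik _]; rewrite leqNgt; apply/negP => lt_ki.
  suff : (prio k < prio i)%N by lia.
  by apply: prio_rel; rewrite ltr_pM2l // ltr_nat.
(* Levels at time 0 depend only on the origins, so those of [S] and [S'] coincide by computation. *)
pose Phi := (\sum_(k in K) minn (level S' 0 k) (gamma0 I))%N.
have Phi_gt0 : (0 < Phi)%N.
  by rewrite /Phi (bigD1 i iK) /= addn_gt0 leq_min gamma0_gt0 i_gt0.
(* [L] joins the two lower bounds: [i] alone needs its distance to the sink, and [K] as a whole
   needs [Phi] rounds. *)
pose L := maxn Phi (level S' 0 i).
have [k kK le_k] : exists2 k, k \in K & (release i + L <= arrival S' k)%N.
  rewrite /L; have [le|lt] := leqP Phi (level S' 0 i).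
    by exists i => //; apply: (release_add_level_le_arrival feasS').
  exact: (exists_late_arrival feasS' relK Phi_gt0).
exists k; first by apply: rel_le; have := bK k kK; lia.
suff le_L : (arrival S j)%:R <= sigma * ((release i + L)%:R : R).
  by rewrite (le_trans le_L) // ler_pM2l // C_ge.
have := gamma0_mul_delay iK i_gt0; rewrite -/Phi.
set D := (\sum_(k in K :\ i) _)%N => le_D.
have le_Dr : 1 + D%:R <= (gamma I)%:R / (gamma0 I)%:R * L%:R :> R.
  rewrite mulrAC ler_pdivlMr // mulrC -(natrD _ 1) -!natrM ler_nat.
  by rewrite (leq_trans le_D) // leq_mul2l leq_maxl orbT.
have le_i : (level S 0 i)%:R <= L%:R :> R by rewrite ler_nat leq_maxr.
have le_jr : (arrival S j)%:R <= (a i)%:R + (level S 0 i)%:R + D%:R :> R.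
  by rewrite -!natrD ler_nat.
(* Of the factor gamma/gamma0 + 1, the summand 1 pays for the distance of [i], and gamma/gamma0 pays
   for the delay [D] and the rounding of the release date. *)
have le_sL : ((gamma I)%:R / (gamma0 I)%:R + 1) * L%:R <= sigma * L%:R.
  by rewrite ler_wpM2r.
have := lt_a i; rewrite /scaled_release /unit_release natrD mulrDr; lra.
Qed.

Theorem theorem4p6 (R : realType) (I : wgp) (sigma : R)
    (hsigma : (gamma I)%:R / (gamma0 I)%:R + 1 <= sigma)
    (S : schedule I) (hS : sigma_fifo sigma S) :
  [/\ delivers S,
      at_most_optimal (maxcost (C_speed sigma S)) (@C I R)
    & at_most_optimal (maxcost (F_speed sigma S)) (@F I R)].
Proof.
split.
- by case: hS => prio [_ _ /greedy_delivers].
- move=> S' feasS'; apply: le_maxcost => j.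
  by have [k _ le_C] := sigma_fifo_dominated j hsigma hS feasS'; exists k.
- move=> S' feasS'; apply: le_maxcost => j.
  have [k le_r le_C] := sigma_fifo_dominated j hsigma hS feasS'; exists k.
  by rewrite /F_speed /F lerB // ler_nat.
Qed.
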